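(* Every generalized complex structure on a real vector space is a $B$-field transform of a direct sum of a complex generalized complex structure and a symplectic generalized complex structure. That is, for every generalized complex structure $\mathcal J$ on a real vector space $V$ there are real subspaces $S,C\subseteq V$ with $V=S\oplus C$, a symplectic form $\omega$ on $S$, a complex structure $J$ on $C$, and a form $B\in\bigwedge^2V^*$, such that $\mathcal J$ is the $B$-field transform defined by $B$ of the direct sum of the symplectic structure on $S$ defined by $\omega$ and the complex generalized complex structure on $C$ defined by $J$.
   Context: All vector spaces are finite-dimensional (possibly zero). On $V\oplus V^*$ use the pairing $\langle v+f,w+g\rangle=-\tfrac12(f(w)+g(v))$. A generalized complex (GC) structure on a real vector space $V$ is an $\mathbb R$-linear automorphism $\mathcal J$ of $V\oplus V^*$ that is orthogonal for $\langle\cdot,\cdot\rangle$ and satisfies $\mathcal J^2=-1$. Endomorphisms of $V\oplus V^*$ are written as $2\times2$ block matrices. A 2-form $B\in\bigwedge^2V^*$ is identified with the skew map $V\to V^*$, $v\mapsto\iota_vB$. The $B$-field transform of $\mathcal J$ defined by (real) $B\in\bigwedge^2V^*$ is $\mathcal B\mathcal J\mathcal B^{-1}$ with $\mathcal B=\begin{pmatrix}1&0\\ B&1\end{pmatrix}$. A complex GC structure is one of the form $\begin{pmatrix}J&0\\0&-J^*\end{pmatrix}$ with $J$ a complex structure ($J\in\operatorname{Aut}_{\mathbb R}$, $J^2=-1$). A symplectic GC structure is one of the form $\begin{pmatrix}0&-\omega^{-1}\\ \omega&0\end{pmatrix}$ with $\omega$ a nondegenerate real 2-form. The direct sum of GC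 structures $\mathcal J_U$ on $U$ and $\mathcal J_{U'}$ on $U'$ is the structure on $U\oplus U'$ given by $\mathcal J_U\oplus\mathcal J_{U'}$ under the natural identification $(U\oplus U')\oplus(U\oplus U')^*\cong U\oplus U^*\oplus U'\oplus U'^*$. *)

(* Defs.v *)
From HB Require Import structures.
From mathcomp Require Import all_boot all_order all_algebra.
From mathcomp Require Import reals.
Set Implicit Arguments.
Unset Strict Implicit.
Unset Printing Implicit Defensive.
Import Order.TTheory GRing.Theory Num.Theory.
Local Open Scope ring_scope.

Section BlockMatrices.
Context {K : fieldType} {U W U' W' : vectType K}.
Variables (a : 'Hom(U, U')) (b : 'Hom(W, U')) (c : 'Hom(U, W')) (d : 'Hom(W, W')).

Definition block_fun (x : (U * W)%type) : (U' * W')%type :=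
  (a x.1 + b x.2, c x.1 + d x.2).

Fact block_fun_linear : linear block_fun.
Proof.
move=> k x y; rewrite /block_fun /= !linearP.
by congr pair; rewrite /= scalerDr addrACA.
Qed.
HB.instance Definition _ :=
  GRing.isLinear.Build K (U * W)%type (U' * W')%type *:%R block_fun
    block_fun_linear.

Definition block_lfun : 'Hom((U * W)%type, (U' * W')%type) := linfun block_fun.

Lemma block_lfunE x : block_lfun x = (a x.1 + b x.2, c x.1 + d x.2).
Proof. exact: lfunE. Qed.

End BlockMatrices.

Section Dual.
Context {K : fieldType} {U W : vectType K}.

Definition dual_fun (h : 'Hom(U, W)) (f : 'Hom(W, K^o)) : 'Hom(U, K^o) :=
  (f \o h)%VF.

Fact dual_fun_linear h : linear (dual_fun h).
Proof. by move=> k f g; rewrite /dual_fun comp_lfunDl comp_lfunZl. Qed.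
HB.instance Definition _ h :=
  GRing.isLinear.Build K 'Hom(W, K^o) 'Hom(U, K^o) *:%R (dual_fun h)
    (dual_fun_linear h).

Definition dual_lfun (h : 'Hom(U, W)) : 'Hom('Hom(W, K^o), 'Hom(U, K^o)) :=
  linfun (dual_fun h).

Lemma dual_lfunE h f : dual_lfun h f = (f \o h)%VF.
Proof. exact: lfunE. Qed.

End Dual.

Section Forms.
Context {R : realType} {V : vectType R}.

(* A map B : V -> V^* represents the bilinear form B(v, w) := B v w, so that
   B v is the contraction iota_v B. *)
Definition two_form (B : 'Hom(V, 'Hom(V, R^o))) : Prop :=
  forall v w, B v w = - B w v.

Definition nondegenerate_form (B : 'Hom(V, 'Hom(V, R^o))) : Prop :=
  forall v, (forall w, B v w = 0) -> v = 0.

Definition symplectic_form (omega : 'Hom(V, 'Hom(V, R^o))) : Prop :=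
  two_form omega /\ nondegenerate_form omega.

Definition complex_structure (J : 'End(V)) : Prop :=
  lker J = 0%VS /\ (J \o J)%VF = - \1%VF.

Definition pairing (x y : (V * 'Hom(V, R^o))%type) : R :=
  - (2^-1 * (x.2 y.1 + y.2 x.1)).

Definition gc_structure (J : 'End((V * 'Hom(V, R^o))%type)) : Prop :=
  [/\ lker J = 0%VS,
      forall x y, pairing (J x) (J y) = pairing x y
    & (J \o J)%VF = - \1%VF].

Definition exp_B (B : 'Hom(V, 'Hom(V, R^o))) : 'End((V * 'Hom(V, R^o))%type) :=
  block_lfun \1%VF 0 B \1%VF.

Definition B_transform (B : 'Hom(V, 'Hom(V, R^o)))
    (J : 'End((V * 'Hom(V, R^o))%type)) : 'End((V * 'Hom(V, R^o))%type) :=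
  (exp_B B \o J \o (exp_B B)^-1)%VF.

Definition complex_gc (J : 'End(V)) : 'End((V * 'Hom(V, R^o))%type) :=
  block_lfun J 0 0 (- dual_lfun J).

Definition symplectic_gc (omega : 'Hom(V, 'Hom(V, R^o))) :
    'End((V * 'Hom(V, R^o))%type) :=
  block_lfun 0 (- omega^-1%VF) omega 0.

(* The inverse ^-1 of 'Hom is a two-sided inverse only for bijective maps. *)
Lemma lker_exp_B B : lker (exp_B B) == 0%VS.
Proof.
apply/lker0P => -[v f] [w g]; rewrite !block_lfunE /= !lfunE /= !addr0.
by case=> -> /addrI->.
Qed.

Lemma lker_nondegenerate omega :
  nondegenerate_form omega -> lker omega == 0%VS.
Proof.
move=> omegaN; apply/lker0P => x y exy; apply/eqP; rewrite -subr_eq0; apply/eqP.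
by apply: omegaN => z; rewrite linearB /= exy subrr lfunE.
Qed.

End Forms.

Section DirectSum.
Context {R : realType} {U U' : vectType R}.

Definition inl_fun (u : U) : (U * U')%type := (u, 0).
Definition inr_fun (u' : U') : (U * U')%type := (0, u').

Fact inl_fun_linear : linear inl_fun.
Proof. by move=> k x y; congr pair; rewrite /= scaler0 addr0. Qed.
HB.instance Definition _ :=
  GRing.isLinear.Build R U (U * U')%type *:%R inl_fun inl_fun_linear.

Fact inr_fun_linear : linear inr_fun.
Proof. by move=> k x y; congr pair; rewrite /= scaler0 addr0. Qed.
HB.instance Definition _ :=
  GRing.isLinear.Build R U' (U * U')%type *:%R inr_fun inr_fun_linear.

Definition sum_ident_fun (x : ((U * U') * 'Hom((U * U')%type, R^o))%type) :
    ((U * 'Hom(U, R^o)) * (U' * 'Hom(U', R^o)))%type :=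
  ((x.1.1, dual_lfun (linfun inl_fun) x.2),
   (x.1.2, dual_lfun (linfun inr_fun) x.2)).

Fact sum_ident_fun_linear : linear sum_ident_fun.
Proof.
by move=> k x y; congr ((_, _), (_, _)); rewrite ?linearP.
Qed.
HB.instance Definition _ :=
  GRing.isLinear.Build R ((U * U') * 'Hom((U * U')%type, R^o))%type
    ((U * 'Hom(U, R^o)) * (U' * 'Hom(U', R^o)))%type *:%R
    sum_ident_fun sum_ident_fun_linear.

(* Sends ((u, u'), f) to ((u, f|U), (u', f|U')). *)
Definition sum_ident :
    'Hom(((U * U') * 'Hom((U * U')%type, R^o))%type,
         ((U * 'Hom(U, R^o)) * (U' * 'Hom(U', R^o)))%type) :=
  linfun sum_ident_fun.

Lemma sum_identE x :
  sum_ident x = ((x.1.1, (x.2 \o linfun inl_fun)%VF),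
                 (x.1.2, (x.2 \o linfun inr_fun)%VF)).
Proof. by rewrite lfunE /= /sum_ident_fun !dual_lfunE. Qed.

Lemma lker_sum_ident : lker sum_ident == 0%VS.
Proof.
apply/lker0P => -[[u u'] f] [[v v'] g]; rewrite !sum_identE /=.
case=> -> /lfunP fl -> /lfunP fr; congr pair; apply/lfunP => -[w w'].
have -> : (w, w') = inl_fun w + inr_fun w'.
  by congr pair; rewrite /= ?addr0 ?add0r.
by move: (fl w) (fr w'); rewrite !comp_lfunE !lfunE !linearD /= => -> ->.
Qed.

Definition gc_direct_sum (J : 'End((U * 'Hom(U, R^o))%type))
    (J' : 'End((U' * 'Hom(U', R^o))%type)) :
    'End(((U * U') * 'Hom((U * U')%type, R^o))%type) :=
  (sum_ident^-1 \o block_lfun J 0 0 J' \o sum_ident)%VF.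

End DirectSum.

Section Transport.
Context {R : realType} {U V : vectType R}.

(* Meaningful when phi is bijective: (u, f) |-> (phi u, f o phi^-1). *)
Definition gc_iso (phi : 'Hom(U, V)) :
    'Hom((U * 'Hom(U, R^o))%type, (V * 'Hom(V, R^o))%type) :=
  block_lfun phi 0 0 (dual_lfun phi^-1%VF).

Definition gc_transport (phi : 'Hom(U, V)) (J : 'End((U * 'Hom(U, R^o))%type)) :
    'End((V * 'Hom(V, R^o))%type) :=
  (gc_iso phi \o J \o (gc_iso phi)^-1)%VF.

End Transport.

Section InternalSum.
Context {R : realType} {V : vectType R} (S C : {vspace V}).

Definition add_subvs_fun (x : (subvs_of S * subvs_of C)%type) : V :=
  vsval x.1 + vsval x.2.

Fact add_subvs_fun_linear : linear add_subvs_fun.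
Proof.
by move=> k x y; rewrite /add_subvs_fun /= scalerDr addrACA.
Qed.
HB.instance Definition _ :=
  GRing.isLinear.Build R (subvs_of S * subvs_of C)%type V *:%R
    add_subvs_fun add_subvs_fun_linear.

(* An isomorphism exactly when V is the internal direct sum of S and C. *)
Definition add_subvs : 'Hom((subvs_of S * subvs_of C)%type, V) :=
  linfun add_subvs_fun.

Lemma add_subvsE x : add_subvs x = vsval x.1 + vsval x.2.
Proof. exact: lfunE. Qed.

End InternalSum.

(* Main.v *)
(* Write J in blocks as (A, b; s, -A^* ) with b and s skew, and let S = im b, q
   the projection onto S along a complement C.  A B-field transform leaves b
   unchanged and replaces A by A + b B.  As b, seen as a map S^* -> S, is
   invertible and skew, it is inverse to minus a symplectic form on S, which
   extended by 0 on C is a form g with b g = - q.  The equation b B = - q A has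
   the skew solution B1 = g A + A^* g - g A q, and the transformed A maps V to C,
   kills S and squares to -1 on C.  The lower left block s1 so obtained pairs
   S with S as g does and S with C trivially; adding B2 = - s1 A / 2, which lives
   on C x C and so does not affect A, turns s1 into g. *)
Require Import Defs.
From mathcomp Require Import all_boot all_order all_algebra.
From mathcomp Require Import reals.
From mathcomp Require Import lra.
Import Order.TTheory GRing.Theory Num.Theory.
Local Open Scope ring_scope.

(** * Functionals, block decompositions and conjugation of linear maps *)

Lemma functionals_separate {K : fieldType} {V : vectType K} (v w : V) :
  (forall f : 'Hom(V, K^o), f v = f w) -> v = w.
Proof.
move=> vw; rewrite (coord_vbasis (memvf v)) (coord_vbasis (memvf w)).
apply: eq_bigr => i _; congr (_ *: _).
by have := vw (linfun (coord (vbasis fullv) i : V -> K^o)); rewrite !lfunE.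
Qed.

Lemma lfun_block_decomposition {R : realType} {U W U' W' : vectType R}
    (h : 'Hom((U * W)%type, (U' * W')%type)) :
  exists a b c d, h = block_lfun a b c d.
Proof.
pose il := linfun (@inl_fun R U W).
pose ir := linfun (@inr_fun R U W).
pose p1 := linfun (fst : (U' * W')%type -> U').
pose p2 := linfun (snd : (U' * W')%type -> W').
exists (p1 \o h \o il)%VF, (p1 \o h \o ir)%VF.
exists (p2 \o h \o il)%VF, (p2 \o h \o ir)%VF.
apply/lfunP => -[u w]; rewrite block_lfunE !comp_lfunE !lfunE /=.
have -> : (u, w) = inl_fun u + inr_fun w.
  by congr pair; rewrite /= ?addr0 ?add0r.
by rewrite linearD [LHS]surjective_pairing.
Qed.

(** On the image of [e] the map [e^-1] is a section, so for surjective [e] an intertwining relation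
    already gives the conjugation formula. *)
Lemma lfun_conj {K : fieldType} {U W : vectType K} (e : 'Hom(U, W))
    (g : 'End(W)) (h : 'End(U)) :
  limg e = fullv -> (forall x, g (e x) = e (h x)) -> g = (e \o h \o e^-1)%VF.
Proof.
move=> e_onto ge; apply/lfunP => y.
by rewrite !comp_lfunE -ge limg_lfunVK // e_onto memvf.
Qed.

Lemma surjective_limg {K : fieldType} {U W : vectType K} (e : 'Hom(U, W)) :
  (forall y, exists x, y = e x) -> limg e = fullv.
Proof.
move=> e_onto; apply/vspaceP => y; rewrite memvf.
by have [x ->] := e_onto y; rewrite memv_img ?memvf.
Qed.

Lemma block_diagE {K : fieldType} {U W U' W' : vectType K}
    (a : 'Hom(U, U')) (d : 'Hom(W, W')) x :
  block_lfun a 0 0 d x = (a x.1, d x.2).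
Proof. by rewrite block_lfunE !zero_lfunE addr0 add0r. Qed.

Lemma block_antidiagE {K : fieldType} {U W U' W' : vectType K}
    (b : 'Hom(W, U')) (c : 'Hom(U, W')) x :
  block_lfun 0 b c 0 x = (b x.2, c x.1).
Proof. by rewrite block_lfunE !zero_lfunE addr0 add0r. Qed.

Lemma exp_BE {R : realType} {V : vectType R} (B : 'Hom(V, 'Hom(V, R^o))) v f :
  exp_B B (v, f) = (v, B v + f).
Proof. by rewrite block_lfunE /= !id_lfunE zero_lfunE addr0. Qed.

Lemma limg_exp_B {R : realType} {V : vectType R} (B : 'Hom(V, 'Hom(V, R^o))) :
  limg (exp_B B) = fullv.
Proof. exact: lker0_limgf (lker_exp_B B). Qed.

(** * GC structures as block matrices and their B-field shifts *)

Section Blocks.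
Context {R : realType} {V : vectType R}.
Implicit Types (A : 'End(V)) (b : 'Hom('Hom(V, R^o), V)).
Implicit Types (s B : 'Hom(V, 'Hom(V, R^o))) (f g : 'Hom(V, R^o)).

(* The matrix (A, b; s, -A^* ) is a GC structure: orthogonality forces the lower
   right block. *)
Definition gc_blocks A b s : Prop :=
  [/\ forall f g, f (b g) = - g (b f),
      two_form s,
      forall v, A (A v) + b (s v) = - v,
      forall f, A (b f) = b (f \o A)%VF
    & forall v w, s (A v) w = s v (A w)].

Definition gc_of_blocks A b s : 'End((V * 'Hom(V, R^o))%type) :=
  block_lfun A b s (- dual_lfun A).

Lemma gc_of_blocksE A b s v f :
  gc_of_blocks A b s (v, f) = (A v + b f, s v - (f \o A)%VF).
Proof. by rewrite block_lfunE /= opp_lfunE dual_lfunE. Qed.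

(** Skewness for the pairing, tested on pure vectors and covectors, gives the lower right block and
    the skewness of [b] and [s]; the entries of the squared matrix give the rest. *)
Lemma gc_structure_blocks (calJ : 'End((V * 'Hom(V, R^o))%type)) :
  gc_structure calJ ->
  exists A b s, gc_blocks A b s /\ calJ = gc_of_blocks A b s.
Proof.
case=> _ orthJ sqrJ.
have [A [b [s [d JB]]]] := lfun_block_decomposition calJ.
have JE v f : calJ (v, f) = (A v + b f, s v + d f) by rewrite JB block_lfunE.
have JJ x : calJ (calJ x) = - x.
  by rewrite -comp_lfunE sqrJ opp_lfunE id_lfunE.
(* Orthogonality and square -1 together make [calJ] skew for the pairing. *)
have skewJ x y : pairing (calJ x) y = - pairing x (calJ y).
  rewrite -(orthJ x) JJ /pairing /= !linearN /= opp_lfunE; lra.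
have dE f : d f = - (f \o A)%VF.
  apply/lfunP => w; have := skewJ (0, f) (w, 0).
  rewrite !JE /pairing /= !linear0 !addr0 !add0r.
  rewrite opp_lfunE comp_lfunE ?zero_lfunE; lra.
exists A, b, s; split; last first.
  by apply/lfunP => -[v f]; rewrite gc_of_blocksE JE dE.
have sk v w : s v w = - s w v.
  have := skewJ (v, 0) (w, 0).
  rewrite !JE /pairing /= !linear0 !addr0 ?zero_lfunE; lra.
have sqr1 v : (A (A v) + b (s v), s (A v) - (s v \o A)%VF) = (- v, 0).
  have := JJ (v, 0); rewrite !JE !dE !linear0 comp_lfun0l oppr0 !addr0 => ->.
  by congr pair; rewrite /= oppr0.
split=> //.
- move=> f g; have := skewJ (0, f) (0, g).
  rewrite !JE !dE /pairing /= !linear0 !add0r ?zero_lfunE; lra.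
- by move=> v; case: (sqr1 v).
- move=> f; have := JJ (0, f); rewrite !JE !dE !linear0 !add0r => -[+ _].
  by rewrite linearN /= oppr0 => /eqP; rewrite subr_eq0 => /eqP.
- move=> v w; case: (sqr1 v) => _ /eqP; rewrite subr_eq0 => /eqP ->.
  by rewrite comp_lfunE.
Qed.

(* A', b, s' are the blocks of exp(-B) J exp(B) if A, b, s are those of J. *)
Definition shifted_blocks A b s B A' s' : Prop :=
  (forall v, A' v = A v + b (B v)) /\
  (forall v w, s' v w = s v w - B v (A w) - B (A' v) w).

(** Comparing second components leaves [B (b f) w = f (b (B w))], which holds because [b] and [B]
    are both skew. *)
Lemma B_transform_blocks A b s B A' s' :
  gc_blocks A b s -> two_form B -> shifted_blocks A b s B A' s' ->
  gc_of_blocks A b s = B_transform B (gc_of_blocks A' b s').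
Proof.
move=> [bsk _ _ _ _] Bsk [A'E s'E]; apply: lfun_conj (limg_exp_B B) _ => -[v f].
rewrite gc_of_blocksE !exp_BE gc_of_blocksE; congr pair.
  by rewrite A'E linearD addrA.
apply/lfunP => w.
rewrite [B (_ + _)]linearD !add_lfunE !opp_lfunE !comp_lfunE add_lfunE.
rewrite s'E [A' w]A'E [f (_ + _)]linearD /=.
rewrite [B (b f) w]Bsk [f (b _)]bsk; lra.
Qed.

(** A direct computation; vector identities are tested against functionals, so that skewness can
    move [b] across the evaluation. *)
Lemma gc_blocks_shift A b s B A' s' :
  gc_blocks A b s -> two_form B -> shifted_blocks A b s B A' s' ->
  gc_blocks A' b s'.
Proof.
move=> [bsk ssk sqA Ab sA] Bsk [A'E s'E].
(* Skewness of [A \o b], which equals [b] after the dual of [A]. *)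
have Abs f g : f (A (b g)) = - g (A (b f)).
  by rewrite Ab bsk !comp_lfunE.
have fbs f v : f (b (s v)) = - f v - f (A (A v)).
  by have /(congr1 f) := sqA v; rewrite linearD linearN /=; lra.
have BD v w u : B (v + w) u = B v u + B w u by rewrite linearD add_lfunE.
have sD v w u : s (v + w) u = s v u + s w u by rewrite linearD add_lfunE.
split=> //.
- move=> v w; rewrite !s'E !A'E !BD.
  rewrite ssk [B v (A w)]Bsk [B w (A v)]Bsk [B (b _) w]Bsk bsk.
  by rewrite [B (b _) v]Bsk; lra.
- move=> v; apply: functionals_separate => f.
  rewrite linearD linearN /= [A' (A' v)]A'E.
  rewrite {1}[A' v]A'E !linearD /=.
  rewrite [f (b (s' _))]bsk s'E Abs.
  by rewrite [s v _]bsk [B (A' v) _]bsk [B v _]Abs fbs; lra.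
- move=> f; apply: functionals_separate => g.
  rewrite !A'E [g (_ + _)]linearD /= Abs [g (b (B _))]bsk [g (b _)]bsk.
  rewrite comp_lfunE A'E [f (_ + _)]linearD /=.
  rewrite [f (b (B _))]bsk Bsk; lra.
- move=> v w; rewrite !s'E [A' (A' v)]A'E [A' w]A'E.
  rewrite ![A (_ + _)]linearD ![s v (_ + _)]linearD ![B _ (_ + _)]linearD BD /=.
  have -> : B (A' v) (b (B w)) = B (b (B (A' v))) w by rewrite bsk -Bsk.
  have -> : B v (A (b (B w))) = B (A (b (B v))) w by rewrite Abs -Bsk.
  have -> : s v (b (B w)) = - B v w - B (A (A v)) w.
    by rewrite bsk fbs Bsk [B w (A _)]Bsk; lra.
  have -> : s (A' v) w = s v (A w) - B v w - B v (A (A w)).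
    by rewrite A'E sD sA [s (b _) w]ssk bsk fbs; lra.
  by rewrite [in A (A' v)]A'E [A (_ + _)]linearD BD /=; lra.
Qed.

End Blocks.

(** * Normal form relative to the image of [b] *)

Section Split.
Context {R : realType} {V : vectType R}.
Variables (A : 'End(V)) (b : 'Hom('Hom(V, R^o), V)).
Variable (s : 'Hom(V, 'Hom(V, R^o))).
Hypothesis gcb : gc_blocks A b s.

Let q := projv (limg b).

Let bsk (f g : 'Hom(V, R^o)) : f (b g) = - g (b f).
Proof. by case: gcb. Qed.

Let qb f : q (b f) = b f.
Proof. by rewrite projv_id // memv_img ?memvf. Qed.

Let q_preim v : exists f, q v = b f.
Proof. by have /memv_imgP[f _ ->] := memv_proj (limg b) v; exists f. Qed.

Lemma gc_blocks_pseudo_inverse :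
  exists g : 'Hom(V, 'Hom(V, R^o)),
  [/\ two_form g, forall v, b (g v) = - q v, forall v, g (q v) = g v
    & forall f w, g (b f) w = - f (q w)].
Proof.
(* [b^-1] only picks some preimage. Two preimages differ by a functional that vanishes on the image
   of [b], by skewness, so composing with the dual of [q] removes the choice. *)
pose g0 := (dual_lfun q \o b^-1 \o q)%VF.
have g0E v w : g0 v w = (b^-1%VF (q v)) (q w).
  by rewrite !comp_lfunE dual_lfunE comp_lfunE.
have bK v : b (b^-1%VF (q v)) = q v by rewrite limg_lfunVK // memv_proj.
have g0sk : two_form g0 by move=> v w; rewrite !g0E -[q w in LHS]bK bsk bK.
have bg0 v : b (g0 v) = q v.
  apply: functionals_separate => f.
  by rewrite bsk g0E qb -bsk bK.
have g0q v : g0 (q v) = g0 v.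
  by apply/lfunP => w; rewrite !g0E /q projv_proj.
have g0b f w : g0 (b f) w = f (q w) by rewrite g0sk -bsk bg0.
exists (- g0); split=> [v w|v|v|f w]; rewrite !opp_lfunE.
- by rewrite g0sk.
- by rewrite [b _]linearN /= bg0.
- by rewrite g0q.
- by rewrite g0b.
Qed.

(** These are the blocks of a direct sum: [A'] lives on the kernel of [q] and squares to -1 there,
    while [b] and [g] live on the image of [q]. *)
Lemma gc_blocks_normal_form :
  exists B A' g,
  [/\ two_form B /\ shifted_blocks A b s B A' g,
      forall v, A' (q v) = 0, forall v, q (A' v) = 0,
      forall v, A' (A' v) = q v - v
    & [/\ two_form g, forall v, b (g v) = - q v, forall v, g (q v) = g v
        & forall f w, g (b f) w = - f (q w)]].
Proof.
have [g [gsk bg gq gb]] := gc_blocks_pseudo_inverse.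
have [_ ssk sqA Ab sA] := gcb.
have Abs (f h : 'Hom(V, R^o)) : f (A (b h)) = - h (A (b f)).
  by rewrite Ab bsk !comp_lfunE.
have [B1 B1E] : exists B1 : 'Hom(V, 'Hom(V, R^o)),
    forall v, B1 v = g (A v) + (g v \o A)%VF - g (A (q v)).
  exists ((g \o A) + (dual_lfun A \o g) - ((g \o A) \o q))%VF => v.
  by rewrite !add_lfunE opp_lfunE !comp_lfunE dual_lfunE.
(* The first two terms of [B1] are exchanged up to sign; the third is skew because [A \o b] is. *)
have B1sk : two_form B1.
  move=> v w; rewrite !B1E !add_lfunE !opp_lfunE !comp_lfunE.
  have : g (A (q v)) w = - g (A (q w)) v.
    have [f qv] := q_preim v; have [h qw] := q_preim w.
    by rewrite qv qw !Ab !gb !comp_lfunE qv qw Abs opprK.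
  rewrite [g (A v) w]gsk [g (A w) v]gsk => ->; lra.
(* As [A] preserves the image of [b], [q] fixes [A (q v)], and the contributions of the last two
   terms of [B1] cancel. *)
have bB1 v : b (B1 v) = - q (A v).
  have [f qv] := q_preim v.
  rewrite B1E !linearD linearN /= !bg -Ab bg linearN /= qv Ab qb.
  by rewrite opprK addrNK.
have [A1 A1E] : exists A1 : 'End(V), forall v, A1 v = A v + b (B1 v).
  by exists (A + (b \o B1))%VF => v; rewrite add_lfunE comp_lfunE.
have [s1 s1E] : exists s1 : 'Hom(V, 'Hom(V, R^o)),
    forall v w, s1 v w = s v w - B1 v (A w) - B1 (A1 v) w.
  exists (s - (dual_lfun A \o B1) - (B1 \o A1))%VF => v w.
  rewrite 2!add_lfunE 2!opp_lfunE [(dual_lfun A \o B1)%VF v]comp_lfunE.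
  rewrite dual_lfunE.
  by rewrite 2!add_lfunE 2!opp_lfunE !comp_lfunE.
have sh1 : shifted_blocks A b s B1 A1 s1 by [].
have [_ s1sk sqA1 A1b s1A1] := gc_blocks_shift _ _ _ _ _ _ gcb B1sk sh1.
have A1q v : A1 (q v) = 0.
  by have [f ->] := q_preim v; rewrite A1E bB1 Ab qb subrr.
have qA1 v : q (A1 v) = 0.
  by rewrite A1E bB1 linearD linearN /= /q projv_proj subrr.
(* Apply [q] to the relation for the square: it kills [A1] and fixes the image of [b]. *)
have bs1 v : b (s1 v) = - q v.
  rewrite -qb -[b _](addKr (A1 (A1 v))) sqA1 linearD !linearN /= qA1.
  by rewrite oppr0 add0r.
have A1A1 v : A1 (A1 v) = q v - v.
  by have /eqP := sqA1 v; rewrite bs1 subr_eq addrC => /eqP.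
(* [B2] enters the shift twice, and each occurrence removes half of [s1 v (w - q w)]; what remains
   is [s1 v (q w)], that is [g v w]. *)
have [B2 B2E] : exists B2 : 'Hom(V, 'Hom(V, R^o)),
    forall v, B2 v = - (2^-1 *: s1 (A1 v)).
  exists (- (2^-1 *: (s1 \o A1)))%VF => v.
  by rewrite opp_lfunE scale_lfunE comp_lfunE.
have B2vE v w : B2 v w = - (2^-1 * s1 (A1 v) w).
  by rewrite B2E opp_lfunE scale_lfunE.
exists (B1 + B2), A1, g; split=> //; split.
  move=> v w; rewrite !add_lfunE B1sk !B2vE s1A1 [s1 v _]s1sk; lra.
split=> [v|v w].
  have bB2 : b (B2 v) = 0.
    by rewrite B2E linearN linearZ /= bs1 qA1 oppr0 scaler0 oppr0.
  by rewrite add_lfunE linearD /= bB2 addr0 A1E.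
have gs1 : g v w = s1 v (q w).
  have [h qw] := q_preim w.
  by rewrite gsk -gq qw gb bsk bs1 linearN /=; lra.
(* The shift involves the original [A], which differs from [A1] by a vector in the image of [b], and
   [A1] kills that image. *)
have A1A : A1 (A w) = A1 (A1 w).
  by rewrite [A1 w]A1E bB1 linearD linearN /= A1q subr0.
rewrite gs1 !add_lfunE !B2vE !s1A1 A1A A1A1 [s1 v (_ - _)]linearD linearN /=.
have := s1E v w; lra.
Qed.

End Split.

(** * Direct sums of GC structures on complementary subspaces *)

Section DirectSumTransport.
Context {R : realType}.

Lemma symplectic_gcE {U : vectType R} (omega : 'Hom(U, 'Hom(U, R^o))) u f :
  symplectic_gc omega (u, f) = (- omega^-1%VF f, omega u).
Proof. by rewrite /symplectic_gc block_antidiagE opp_lfunE. Qed.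

Lemma complex_gcE {U : vectType R} (J : 'End(U)) u (f : 'Hom(U, R^o)) :
  complex_gc J (u, f) = (J u, - (f \o J)%VF).
Proof. by rewrite /complex_gc block_diagE opp_lfunE dual_lfunE. Qed.

(** Since [sum_ident] is injective, its inverse need never be computed. *)
Lemma gc_direct_sum_eq {U U' : vectType R}
    (J : 'End((U * 'Hom(U, R^o))%type))
    (J' : 'End((U' * 'Hom(U', R^o))%type)) x y :
  (J (sum_ident x).1, J' (sum_ident x).2) = sum_ident y ->
  gc_direct_sum J J' x = y.
Proof.
move=> xy; rewrite /gc_direct_sum 2!comp_lfunE block_lfunE 2!zero_lfunE.
rewrite addr0 add0r xy lker0_lfunK; first by [].
exact: lker_sum_ident.
Qed.

Lemma gc_direct_sumE {U U' : vectType R} (omega : 'Hom(U, 'Hom(U, R^o)))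
    (J : 'End(U')) u u' (f h : 'Hom((U * U')%type, R^o)) :
  (forall v v', h (v, v') = omega u v - f (0, J v')) ->
  gc_direct_sum (symplectic_gc omega) (complex_gc J) ((u, u'), f) =
  ((- omega^-1%VF (f \o linfun inl_fun)%VF, J u'), h).
Proof.
move=> hE; apply: gc_direct_sum_eq.
rewrite !sum_identE symplectic_gcE complex_gcE.
congr pair; congr pair; apply/lfunP => w.
  by rewrite comp_lfunE lfunE hE (linear0 J) (linear0 f) subr0.
rewrite opp_lfunE 3!comp_lfunE [linfun inr_fun w]lfunE [linfun inr_fun _]lfunE.
by rewrite hE (linear0 (omega u)) sub0r.
Qed.

Lemma gc_isoE {U W : vectType R} (phi : 'Hom(U, W)) u (h : 'Hom(U, R^o)) :
  gc_iso phi (u, h) = (phi u, (h \o phi^-1)%VF).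
Proof. by rewrite /gc_iso block_diagE dual_lfunE. Qed.

Section Internal.
Context {V : vectType R} (S C : {vspace V}).
Hypotheses (SC1 : (S + C)%VS = fullv) (SC0 : (S :&: C)%VS = 0%VS).

Lemma limg_add_subvs : limg (add_subvs S C) = fullv.
Proof.
apply: surjective_limg => v; have := memvf v; rewrite -SC1.
case/memv_addP => x xS [y yC ->].
by exists (vsproj S x, vsproj C y); rewrite add_subvsE /= !vsprojK.
Qed.

Lemma lker_add_subvs : lker (add_subvs S C) == 0%VS.
Proof.
rewrite -subv0; apply/subvP => -[x y]; rewrite memv_ker add_subvsE /=.
rewrite addr_eq0 memv0 => /eqP xy.
have : vsval x \in (S :&: C)%VS.
  by rewrite memv_cap subvsP xy rpredN subvsP.
rewrite SC0 memv0 => /eqP x0.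
move/eqP: xy; rewrite x0 eq_sym oppr_eq0 => /eqP y0.
by apply/eqP; congr pair; apply: val_inj.
Qed.

Lemma limg_gc_iso : limg (gc_iso (add_subvs S C)) = fullv.
Proof.
apply: surjective_limg => -[v f].
have vK w : add_subvs S C ((add_subvs S C)^-1%VF w) = w.
  by rewrite limg_lfunVK // limg_add_subvs memvf.
exists ((add_subvs S C)^-1%VF v, (f \o add_subvs S C)%VF).
rewrite gc_isoE vK; congr pair.
by apply/lfunP => w; rewrite !comp_lfunE vK.
Qed.

Lemma gc_of_blocks_direct_sum (A : 'End(V)) (b : 'Hom('Hom(V, R^o), V))
    (g : 'Hom(V, 'Hom(V, R^o)))
    (omega : 'Hom(subvs_of S, 'Hom(subvs_of S, R^o))) (J : 'End(subvs_of C)) :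
  nondegenerate_form omega ->
  (forall x, A (vsval x : V) = vsval (J x)) ->
  (forall x : subvs_of S, A (vsval x) = 0) ->
  (forall x y, omega x y = g (vsval x) (vsval y)) ->
  two_form g -> (forall x : subvs_of C, g (vsval x) = 0) ->
  (forall f, b f \in S) ->
  (forall f (x : subvs_of S), g (b f) (vsval x) = - f (vsval x)) ->
  gc_of_blocks A b g =
  gc_transport (add_subvs S C)
    (gc_direct_sum (symplectic_gc omega) (complex_gc J)).
Proof.
move=> omegaN AC AS omegaE gsk gC bS gb.
apply: lfun_conj limg_gc_iso _ => -[[x y] f].
set phi := add_subvs S C.
have phiE u v : phi (u, v) = vsval u + vsval v by rewrite add_subvsE.
have phiK : cancel phi phi^-1%VF by apply: lker0_lfunK lker_add_subvs.
have phiVK w : phi (phi^-1%VF w) = w.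
  by rewrite limg_lfunVK // limg_add_subvs memvf.
have Aphi v w : A (phi (v, w)) = phi (0, J w).
  by rewrite !phiE linearD /= AC AS !add0r.
have gphi u v : g (phi u) (phi v) = omega u.1 v.1.
  have gC' z (w : subvs_of C) : g z (vsval w) = 0.
    by rewrite gsk gC zero_lfunE oppr0.
  case: u v => [u u'] [v v']; rewrite !phiE [g (_ + _)]linearD add_lfunE /=.
  rewrite [g (vsval u) _]linearD [g (vsval u') _]linearD /=.
  by rewrite !gC' gC zero_lfunE !addr0 omegaE.
(* The covector component of the left side; its pullback by [phi] is the one the direct sum
   produces. *)
pose k := (g (phi (x, y)) - ((f \o phi^-1) \o A))%VF.
have kE v w : (k \o phi)%VF (v, w) = omega x v - f (0, J w).
  by rewrite comp_lfunE add_lfunE opp_lfunE !comp_lfunE gphi Aphi phiK.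
rewrite (gc_direct_sumE _ _ _ _ _ _ kE).
rewrite !gc_isoE gc_of_blocksE; congr pair; last first.
  by apply/lfunP => v; rewrite !comp_lfunE phiVK.
rewrite Aphi !phiE linear0 add0r addrC; congr (_ + _).
pose z := vsproj S (b (f \o phi^-1)%VF).
have bz : b (f \o phi^-1)%VF = vsval z by rewrite vsprojK.
rewrite bz; congr vsval.
(* By the hypothesis [gb], [b] acts as minus the inverse of [omega], which matches the sign in
   [symplectic_gc]. *)
have -> : (f \o linfun inl_fun)%VF = omega (- z).
  apply/lfunP => v; rewrite linearN opp_lfunE omegaE -bz gb opprK.
  rewrite !comp_lfunE lfunE.
  by rewrite -[vsval v]addr0 -[0 in RHS](linear0 (@vsval _ _ C)) -phiE phiK.
by rewrite lker0_lfunK ?opprK // lker_nondegenerate.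
Qed.

End Internal.

End DirectSumTransport.

Theorem theorem3p8 (R : realType) (V : vectType R)
    (calJ : 'End((V * 'Hom(V, R^o))%type)) (hJ : gc_structure calJ) :
  exists (S C : {vspace V})
         (omega : 'Hom(subvs_of S, 'Hom(subvs_of S, R^o)))
         (J : 'End(subvs_of C))
         (B : 'Hom(V, 'Hom(V, R^o))),
    [/\ (S + C)%VS = fullv /\ (S :&: C)%VS = 0%VS,
        symplectic_form omega,
        complex_structure J,
        two_form B
      & calJ = B_transform B
              (gc_transport (add_subvs S C)
                 (gc_direct_sum (symplectic_gc omega) (complex_gc J)))].
Proof.
have [A [b [s [gcb ->]]]] := gc_structure_blocks calJ hJ.
have [B [A' [g [[Bsk shift] A'q qA' A'A' [gsk bg gq gb]]]]] :=
  gc_blocks_normal_form A b s gcb.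
(* [C] is the complement along which [projv] projects, hence the kernel of [q]. *)
pose S := limg b; pose C := (S^C)%VS; set q := projv _ in A'q qA' A'A' bg gq gb.
have qS (x : subvs_of S) : q (vsval x) = vsval x by rewrite /q projv_id ?subvsP.
have qC (x : subvs_of C) : q (vsval x) = 0.
  by apply/eqP; rewrite -memv_ker lker_proj subvsP.
have A'C v : A' v \in C.
  by have : A' v \in lker q; [rewrite memv_ker qA' | rewrite lker_proj].
have [omega omegaE] : exists omega : 'Hom(subvs_of S, 'Hom(subvs_of S, R^o)),
    forall x y, omega x y = g (vsval x) (vsval y).
  pose i := linfun (vsval : subvs_of S -> V).
  exists (dual_lfun i \o g \o i)%VF => x y.
  by rewrite !comp_lfunE dual_lfunE comp_lfunE !lfunE.
have [J JE] : exists J : 'End(subvs_of C), forall x, vsval (J x) = A' (vsval x).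
  exists (linfun (vsproj C) \o A' \o linfun vsval)%VF => x.
  by rewrite !comp_lfunE !lfunE /= vsprojK.
have JJ x : J (J x) = - x.
  by apply: val_inj; rewrite /= !JE A'A' qC sub0r.
(* Here [x = - b (g x)], and [g x] depends only on its values on [S], which are those of
   [omega x]. *)
have omegaN : nondegenerate_form omega.
  move=> x x0; apply: val_inj; rewrite /= -[LHS]opprK -qS -bg.
  suff -> : g (vsval x) = 0 by rewrite linear0 oppr0.
  apply/lfunP => w; rewrite zero_lfunE gsk -gq -gsk.
  by have := x0 (vsproj S (q w)); rewrite omegaE vsprojK // memv_proj.
exists S, C, omega, J, B; split=> //.
- by split; [apply: addv_complf | apply: capv_compl].
- by split=> // x y; rewrite !omegaE.
- split; last by apply/lfunP => x; rewrite comp_lfunE JJ opp_lfunE id_lfunE.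
  by apply/eqP/lker0P => x y Jxy; apply: oppr_inj; rewrite -!JJ Jxy.
- rewrite (B_transform_blocks _ _ _ _ _ _ gcb Bsk shift); congr (B_transform B).
  apply: gc_of_blocks_direct_sum => //.
  + exact: addv_complf.
  + exact: capv_compl.
  + by move=> x; rewrite -qS A'q.
  + by move=> x; rewrite -gq qC linear0.
  + by move=> f; rewrite memv_img ?memvf.
  + by move=> f x; rewrite gb qS.
Qed.
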